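(* Consider the forward PDE system $$\partial_tu(t,x)=\mathscr{F}u(t,x),\quad x\in\Omega\subset\mathbb{R}^n,\ t\in[0,t_0],\qquad y(t)=\mathscr{H}u(t,\cdot),\qquad u(0,\cdot)=u_0\in\mathcal{U}_0\subset\mathrm{Dom}(\mathscr{F}),\qquad u\in\mathcal{U}_b,$$ assumed well-posed, with state space $\mathcal{U}$. Given a set of initial conditions $\mathcal{U}_0\subseteq\mathcal{U}$, an undesirable set $\mathcal{Y}_u=\{u\in\mathcal{U}\mid\mathscr{H}u\le0\}$ such that $\mathcal{U}_0\cap\mathcal{Y}_u=\emptyset$, and a constant $t_0>0$, suppose there exists a barrier functional $B(t,u)$ such that $t\mapsto B(t,u(t,\cdot))$ is continuously differentiable along the solutions of the system, and such that (i) $B(t_0,u(t_0,\cdot))-B(0,u_0)>0$ for all $u(t_0,\cdot)\in\mathcal{Y}_u$ and all $u_0\in\mathcal{U}_0$; (ii) $\dfrac{\mathrm{d}B(t,u(t,\cdot))}{\mathrm{d}t}\le0$ for all $t\in[0,t_0]$ and all $u\in\mathcal{U}$, along the solutions of the system. Then the solutions of the system avoid $\mathcal{Y}_u$ at time $t_0$: every solution $u$ with $u(0,\cdot)\in\mathcal{U}_0$ satisfies $u(t_0,\cdot)\notin\mathcal{Y}_u$.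
   Context: $\mathcal{U}$ is a Hilbert space of functions on the domain $\Omega\subset\mathbb{R}^n$, the state space of the system; $\mathcal{U}_b$ is the subspace of $\mathcal{U}$ defined by the boundary conditions on $u$; $\mathscr{F}$ is a (possibly nonlinear) operator with domain $\mathrm{Dom}(\mathscr{F})$; $\mathscr{H}:\mathcal{U}\to\mathbb{R}$ is the output map. Well-posedness means that for each admissible initial condition the system has a unique solution $t\mapsto u(t,\cdot)\in\mathcal{U}$. A barrier functional is a family $B(t,u)=\mathscr{B}(t)u$ of (not necessarily linear) maps $\mathscr{B}(t):\mathrm{Dom}(\mathscr{B})\to\mathbb{R}$ with $\mathrm{Dom}(\mathscr{B})\supseteq\mathcal{U}$. ''Along the solutions'' means: evaluated on any solution $t\mapsto u(t,\cdot)$ of the system. *)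

(* Defs.v *)
From HB Require Import structures.
From mathcomp Require Import all_boot all_order all_algebra.
From mathcomp Require Import all_classical all_reals all_analysis.
From mathcomp Require Import sesquilinear.

Set Implicit Arguments.
Unset Strict Implicit.
Unset Printing Implicit Defensive.

Import Order.TTheory GRing.Theory Num.Theory.
Import numFieldNormedType.Exports.
Local Open Scope classical_set_scope.
Local Open Scope ring_scope.

Section derive_within.
Context {R : realType} {V : normedModType R}.

(* Derivatives relative to a set A of times: two-sided at interior points of
   A = `[0, t0] and one-sided at its two endpoints. *)
Definition diff_quotient (f : R -> V) (t s : R) : V :=
  (s - t)^-1 *: (f s - f t).

Definition derivable_within (A : set R) (f : R -> V) (t : R) : Prop :=
  cvg (diff_quotient f t s @[s --> within A t^']).

Definition derive1_within (A : set R) (f : R -> V) (t : R) : V :=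
  lim (diff_quotient f t s @[s --> within A t^']).

Definition continuously_derivable_within (A : set R) (f : R -> V) : Prop :=
  (forall t, A t -> derivable_within A f t) /\
  {within A, continuous (derive1_within A f)}.

End derive_within.

(* A real Hilbert space whose elements are functions Omega -> R^m. The elements
   are given through a linear injective realization as functions, so that
   spaces of classes of functions (L^2, Sobolev spaces) are covered as well, by
   a linear choice of representatives. *)
Record hilbert_function_space (R : realType) (n m : nat)
    (Omega : set 'rV[R]_n) := HilbertFunctionSpace {
  hfs_sort :> completeNormedModType R ;
  inner : {dot hfs_sort for (@idfun R)} ;
  inner_norm : forall u : hfs_sort, inner u u = `|u| ^+ 2 ;
  fun_of : {linear hfs_sort -> (Omega -> 'rV[R]_m)} ;
  fun_of_inj : injective fun_of }.

(* The data of du/dt = F u, y = H u, u \in U_b. Only the values of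
   [pde_op] on [pde_dom] are meaningful; F u is a function on Omega which need
   not belong to the state space. *)
Record forward_pde (R : realType) (n m : nat) (Omega : set 'rV[R]_n)
    (U : hilbert_function_space m Omega) := ForwardPDE {
  pde_dom : set U ;
  pde_op : U -> Omega -> 'rV[R]_m ;
  pde_output : U -> R ;
  pde_bc : set U ;
  pde_bc_submod : submod_closed (mem pde_bc) }.

Section forward_pde_theory.
Context {R : realType} {n m : nat} {Omega : set 'rV[R]_n}
  {U : hilbert_function_space m Omega}.

(* Only the restriction of u to [0, t0] matters. *)
Definition solution (S : forward_pde U) (t0 : R) (u0 : U) (u : R -> U) : Prop :=
  u 0 = u0 /\
  forall t, `[0, t0]%classic t ->
    [/\ pde_dom S (u t), pde_bc S (u t) &
        forall x : Omega,
          derivable_within `[0, t0] (fun s => fun_of U (u s) x) t /\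
          derive1_within `[0, t0] (fun s => fun_of U (u s) x) t
            = pde_op S (u t) x].

Definition well_posed (S : forward_pde U) (U0 : set U) (t0 : R) : Prop :=
  forall u0, U0 u0 ->
    (exists u, solution S t0 u0 u) /\
    (forall u v, solution S t0 u0 u -> solution S t0 u0 v ->
       {in `[0, t0], u =1 v}).

Definition undesirable_set (S : forward_pde U) : set U := [set v | pde_output S v <= 0].

End forward_pde_theory.

(* Main.v *)
(** Along a solution, t |-> B(t, u(t)) has nonpositive derivative on [0, t0], so
    the mean value theorem gives B(t0, u(t0)) <= B(0, u0), which contradicts (i)
    when u(t0) is undesirable. *)

Require Import Defs.
From HB Require Import structures.
From mathcomp Require Import all_boot all_order all_algebra.
From mathcomp Require Import all_classical all_reals all_analysis.
Import Order.TTheory GRing.Theory Num.Theory.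
Import numFieldNormedType.Exports.
Local Open Scope classical_set_scope.
Local Open Scope ring_scope.

(** Once a solution is fixed, [B t (u t)] is a real function of time alone, so the claim is
    one-variable calculus: a nonpositive derivative forbids the strict increase that (i), taken at
    [u t0], demands ([derive1_within_le0_le]). The mean value theorem wants two-sided derivatives
    inside the interval and continuity up to its endpoints; [derivable_within_is_derive] and
    [derivable_within_cvg] extract these from derivatives relative to the interval. *)

Lemma derivable_within_is_derive (R : realType) (A : set R) (f : R -> R) (t : R) :
  A° t -> derivable_within A f t -> is_derive t 1 f (derive1_within A f t).
Proof.
move=> At df.
suff q : h^-1 *: ((f \o shift t) (h *: 1) - f t) @[h --> 0^'] -->
         derive1_within A f t.
  split; first by apply/cvg_ex; exists (derive1_within A f t).
  exact: cvg_lim q.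
have -> : (fun h : R => h^-1 *: ((f \o shift t) (h *: 1) - f t)) =
          diff_quotient f t \o shift t.
  by apply/funext => h; rewrite /diff_quotient /= addrK [h *: 1]mulr1.
apply: (cvg_comp (shift t) (diff_quotient f t) _ df) => P tP.
have {}tP : \forall s \near t, s != t -> P s.
  have {}tP : \forall s \near t, s != t -> A s -> P s := tP.
  near=> s => st; apply: (near tP s) => //; near: s; exact: At.
have {}tP : \forall h \near (0 : R), h + t != t -> P (h + t).
  by move: tP; rewrite (near_shift 0) subr0.
change (\forall h \near (0 : R), h != 0 -> P (h + t)).
by near=> h => h0; apply: (near tP h) => //=; rewrite -subr_eq0 addrK.
Unshelve. all: by end_near. Qed.

(** The increment [f s - f t] is [s - t] times the difference quotient, hence tends to 0 times the
    derivative. Keeping [s] in [A] covers endpoints too. *)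
Lemma derivable_within_cvg (R : realType) (A : set R) (f : R -> R) (t : R) :
  derivable_within A f t -> f @ within A (nbhs t) --> f t.
Proof.
move=> df.
have cf : (s - t) *: diff_quotient f t s @[s --> within A t^'] --> (0 : R).
  rewrite -(scale0r (derive1_within A f t)); apply: cvgZ df.
  rewrite -(subrr t); apply: cvgB; last exact: cvg_cst.
  apply: cvg_trans (cvg_id (F := nbhs t)) => P tP.
  by apply: cvg_within; apply: cvg_within.
apply/cvgrPdist_lt => e e0.
move/cvgrPdist_lt: cf => /(_ e e0) te.
have {}te : \forall s \near t, s != t -> A s ->
    `|0 - (s - t) *: diff_quotient f t s| < e := te.
change (\forall s \near t, A s -> `|f t - f s| < e).
near=> s => As; have [->|st] := eqVneq s t; first by rewrite subrr normr0.
have := near te s _ st As; rewrite /diff_quotient sub0r normrN scalerA.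
by rewrite divff ?subr_eq0// scale1r distrC; apply.
Unshelve. all: by end_near. Qed.

Lemma derive1_within_le0_le (R : realType) (a b : R) (f : R -> R) :
  a < b ->
  {in `[a, b], forall t, derivable_within `[a, b] f t} ->
  {in `]a, b[, forall t, derive1_within `[a, b] f t <= 0} ->
  f b <= f a.
Proof.
move=> ab df df_le0.
have is_df t : t \in `]a, b[ -> is_derive t 1 f (derive1_within `[a, b] f t).
  move=> tab; apply: derivable_within_is_derive; first by rewrite interior_itv.
  by apply: df; exact: subset_itv_oo_cc tab.
have cf : {within `[a, b], continuous f}.
  by apply/subspace_continuousP => t /df /derivable_within_cvg.
have [c cab fE] := MVT ab is_df cf.
by rewrite -subr_le0 fE mulr_le0_ge0 ?df_le0// subr_ge0 ltW.
Qed.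

Theorem theorem4 (R : realType) (n m : nat) (Omega : set 'rV[R]_n)
    (U : hilbert_function_space m Omega) (S : forward_pde U)
    (U0 : set U) (t0 : R) :
  0 < t0 ->
  U0 `<=` pde_dom S ->
  well_posed S U0 t0 ->
  U0 `&` undesirable_set S = set0 ->
  (exists B : R -> U -> R,
    [/\ (forall u0 u, U0 u0 -> solution S t0 u0 u ->
           continuously_derivable_within `[0, t0] (fun t => B t (u t))),
        (forall v u0, undesirable_set S v -> U0 u0 ->
           0 < B t0 v - B 0 u0) &
        (forall u0 u, U0 u0 -> solution S t0 u0 u ->
           forall t, `[0, t0]%classic t ->
             derive1_within `[0, t0] (fun s => B s (u s)) t <= 0)]) ->
  forall u0 u, U0 u0 -> solution S t0 u0 u -> ~ undesirable_set S (u t0).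
Proof.
move=> t0_gt0 _ _ _ [B [dB B_gt0 dB_le0]] u0 u U0u0 sol ut0.
(* Writing [u0] as [u 0] turns (i) into a comparison of two values of the same function
   [B t (u t)]. *)
have := B_gt0 _ _ ut0 U0u0; rewrite -sol.1 subr_gt0 ltNge => /negP; apply.
have [df _] := dB _ _ U0u0 sol.
apply: (@derive1_within_le0_le R 0 t0 (fun t => B t (u t))) => // t t_itv.
by apply: dB_le0 U0u0 sol _ _; exact: subset_itv_oo_cc t_itv.
Qed.
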